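(* Let $\phi$ be a satisfiable $\mathbf G_1(\mathbf F_q,\mathbf G_1)$-formula. Then $\phi$ has a model with at most $|\phi|$ states.
   Context: Fix a finite set $\mathcal A$ of atomic propositions. A Markov chain is a tuple $M=(S,P,s_0,L)$ with $S$ countable, $P:S\times S\to[0,1]$ with $\sum_{t}P(s,t)=1$ for all $s$, initial state $s_0$, labeling $L:S\to2^{\mathcal A}$. $\mathbb P_{M(s)}$ is the standard probability measure on runs from $s$ (cylinder of $\rho_0\cdots\rho_n$, $\rho_0=s$, has probability $\prod_{i<n}P(\rho_i,\rho_{i+1})$); $\pi[i]$ is the $i$-th state of run $\pi$. Formulae of PCTL$(\mathbf F,\mathbf G)$: $a,\neg a$ ($a\in\mathcal A$), $\wedge,\vee$, $\mathbf F_{\rhd q}\varphi$, $\mathbf G_{\rhd q}\varphi$ with $\rhd\in\{\ge,>\}$, $q\in[0,1]\cap\mathbb Q$; $M,s\models\mathbf F_{\rhd q}\varphi$ iff $\mathbb P_{M(s)}(\{\pi\mid\exists i: M,\pi[i]\models\varphi\})\rhd q$, $M,s\models\mathbf G_{\rhd q}\varphi$ iff $\mathbb P_{M(s)}(\{\pi\mid\forall i: M,\pi[i]\models\varphi\})\rhd q$, literals and Boolean connectives as usual ($a$ holds iff $a\in L(s)$). $=1$ means $\ge 1$. $M$ is a model of $\phi$ if $M,s_0\models\phi$; $\phi$ is satisfiable if it has a (countable) model. $|\phi|$ is the length of $\phi$. A $\mathbf G_1(\mathbf F_q,\mathbf G_1)$-formula is $\mathbf G_{=1}\Psi$ where $\Psi::=a\mid\neg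 a\mid\Psi\wedge\Psi\mid\mathbf F_{\rhd q}\Psi\mid\mathbf G_{=1}\Psi$ (no disjunction; $\rhd\in\{\ge,>\}$, $q\in[0,1]\cap\mathbb Q$). *)

(* Defs.v *)
From HB Require Import structures.
From mathcomp Require Import all_boot all_order all_algebra.
From mathcomp Require Import all_classical all_reals all_analysis.

Set Implicit Arguments.
Unset Strict Implicit.
Unset Printing Implicit Defensive.

Import Order.TTheory GRing.Theory Num.Theory.
Local Open Scope classical_set_scope.
Local Open Scope ring_scope.

Inductive comparison_op := Geq | Gt.

Definition threshold := {q : rat | 0 <= q <= 1}.

Definition threshold1 : threshold := exist (fun q : rat => 0 <= q <= 1) 1 isT.

Inductive pctl (A : Type) :=
| Atom of A
| NegAtom of A
| And of pctl A & pctl A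
| Or of pctl A & pctl A
| Fin of comparison_op & threshold & pctl A
| Glob of comparison_op & threshold & pctl A.

(* Number of symbols, each of [F] and [G] counting as one symbol together with
   its subscript; in particular a negated atom has length 2. *)
Fixpoint flength (A : Type) (phi : pctl A) : nat :=
  match phi with
  | Atom _ => 1
  | NegAtom _ => 2
  | And phi1 phi2 | Or phi1 phi2 => (flength phi1 + flength phi2).+1
  | Fin _ _ phi1 | Glob _ _ phi1 => (flength phi1).+1
  end.

Definition Glob1 (A : Type) (psi : pctl A) : pctl A := Glob Geq threshold1 psi.

Inductive FqG1_formula (A : Type) : pctl A -> Prop :=
| FqG1_Atom a : FqG1_formula (Atom a)
| FqG1_NegAtom a : FqG1_formula (NegAtom a)
| FqG1_And psi1 psi2 :
    FqG1_formula psi1 -> FqG1_formula psi2 -> FqG1_formula (And psi1 psi2)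
| FqG1_Fin op q psi : FqG1_formula psi -> FqG1_formula (Fin op q psi)
| FqG1_Glob1 psi : FqG1_formula psi -> FqG1_formula (Glob1 psi).

Definition G1FqG1_formula (A : Type) (phi : pctl A) : Prop :=
  exists2 psi, FqG1_formula psi & phi = Glob1 psi.

Record markov_chain (R : realType) (A : finType) := MarkovChain {
  state : countType;
  trans : state -> state -> R;
  init : state;
  label : state -> {set A};
  trans01 : forall s t, 0 <= trans s t <= 1;
  trans_sum1 : forall s, (\esum_(t in [set: state]) (trans s t)%:E = 1)%E }.

Arguments init {R A} m.

Section Runs.
Context (R : realType) (A : finType) (M : markov_chain R A).

Definition run := nat -> state M.
HB.instance Definition _ := Choice.on run.
HB.instance Definition _ := isPointed.Build run (fun=> init M).

Definition cylinder (n : nat) (rho : run) : set run :=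
  [set pi | forall i, (i <= n)%N -> pi i = rho i].

Definition cylinders : set (set run) :=
  [set C | exists n rho, C = cylinder n rho].

Notation run_space := (g_sigma_algebraType cylinders).

(* Runs range over all sequences of states; those not starting in [s] get
   probability 0. *)
Definition is_run_measure (s : state M) (mu : probability run_space R) : Prop :=
  forall n (rho : run), mu (cylinder n rho) =
    (if rho 0%N == s then \prod_(i < n) trans (rho i) (rho i.+1) else 0)%:E.

(* Existence of the run measure: from the uniform law on [0, 1[, choose the
   next state [t] according to the subinterval of length [trans s t] that
   contains [u], then rescale that subinterval to [0, 1[ and iterate. *)

Definition wt (s : state M) (k : nat) : R :=
  if pickle_inv k is Some t then trans s t else 0.

Definition cum (s : state M) (n : nat) : R := \sum_(k < n) wt s k.

Lemma wt_ge0 s k : 0 <= wt s k.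
Proof.
by rewrite /wt; case: pickle_inv => // t; case/andP: (trans01 s t).
Qed.

Lemma wt_pickle s t : wt s (pickle t) = trans s t.
Proof. by rewrite /wt pickleK_inv. Qed.

Lemma cumS s n : cum s n.+1 = cum s n + wt s n.
Proof. by rewrite /cum big_ord_recr. Qed.

Lemma cum_ge0 s n : 0 <= cum s n.
Proof. by apply: sumr_ge0 => i _; exact: wt_ge0. Qed.

Lemma le_cum s m n : (m <= n)%N -> cum s m <= cum s n.
Proof.
move=> mn; rewrite -(subnKC mn); elim: (n - m)%N => [|k IH].
  by rewrite addn0.
by rewrite addnS cumS (le_trans IH)// lerDl wt_ge0.
Qed.

Lemma wt_series s : (\sum_(k <oo) (wt s k)%:E = 1)%E.
Proof.
rewrite nneseries_esumT; last by move=> n; rewrite lee_fin wt_ge0.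
rewrite -(trans_sum1 s).
transitivity (\esum_(k in range (@pickle (state M))) (wt s k)%:E)%E.
  rewrite [RHS]esum_mkcond; apply: eq_esum => k _; case: ifPn => //.
  rewrite notin_setE /= => nk; rewrite /wt.
  case E : (pickle_inv k) => [t|//]; exfalso; apply: nk; exists t => //.
  by have := pickle_invK (T := state M) k; rewrite /= /oapp E.
rewrite (reindex_esum [set: state M] _ (@pickle (state M))); last first.
  split=> [x _|x y _ _|//]; first by exists x.
  exact: (pcan_inj (@pickleK _)).
by apply: eq_esum => t _; rewrite wt_pickle.
Qed.

Lemma cum_le1 s n : cum s n <= 1.
Proof.
rewrite -lee_fin -(wt_series s) /cum -sumEFin -(big_mkord xpredT (fun k => (wt s k)%:E)).
by apply: nneseries_lim_ge => k _; rewrite lee_fin wt_ge0.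
Qed.

Lemma cum_gt s u : u < 1 -> exists n, u < cum s n.
Proof.
move=> u1; apply: contrapT => /forallNP h.
suff : (1%:E <= u%:E)%E by rewrite lee_fin leNgt u1.
rewrite -(wt_series s); apply: lime_le.
  by apply: is_cvg_nneseries => k _; rewrite lee_fin wt_ge0.
apply: nearW => n; rewrite big_mkord sumEFin lee_fin leNgt.
exact/negP/h.
Qed.

Definition next_spec s u t := cum s (pickle t) <= u < cum s (pickle t) + trans s t.

Lemma next_ex s u : 0 <= u < 1 -> exists t, next_spec s u t.
Proof.
move=> /andP[u0 /(cum_gt s) ex].
case: (ex_minnP ex) => -[|n]; first by rewrite /cum big_ord0 ltNge u0.
rewrite cumS => un hmin.
have un' : cum s n <= u by rewrite leNgt; apply/negP => /hmin; rewrite ltnn.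
have : wt s n != 0.
  by apply/eqP => w0; move: un; rewrite w0 addr0 ltNge un'.
rewrite /wt; case E : (pickle_inv n) => [t|]; last by rewrite eqxx.
have En : pickle t = n by have := pickle_invK (T := state M) n; rewrite /= /oapp E.
by move=> _; exists t; rewrite /next_spec En un' -wt_pickle En.
Qed.

Lemma next_uniq s u t t' : next_spec s u t -> next_spec s u t' -> t = t'.
Proof.
move=> /andP[h1 h2] /andP[h3 h4]; apply: (pcan_inj (@pickleK _)).
rewrite -!wt_pickle -!cumS in h2 h4.
case: (ltngtP (pickle t) (pickle t')) => // lt; exfalso.
  by move: (le_lt_trans (le_trans (le_cum s lt) h3) h2); rewrite ltxx.
by move: (le_lt_trans (le_trans (le_cum s lt) h1) h4); rewrite ltxx.
Qed.

Definition next s u : state M := xget (init M) [set t | next_spec s u t].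

Lemma nextP s u t : 0 <= u < 1 -> next s u = t <-> next_spec s u t.
Proof.
move=> u01; have [t' ht'] := next_ex s u01.
have hn : next_spec s u (next s u) by exact: (@xgetPex _ (init M) [set t | next_spec s u t] (ex_intro _ t' ht')).
by split=> [<-//|]; exact: next_uniq.
Qed.

Definition resid s u : R :=
  (u - cum s (pickle (next s u))) / trans s (next s u).

Fixpoint sample (n : nat) (s : state M) (u : R) : state M :=
  if n is m.+1 then sample m (next s u) (resid s u) else s.

Lemma sample_cylinder n (rho : run) : exists2 a : R, 0 <= a &
  a + \prod_(i < n) trans (rho i) (rho i.+1) <= 1 /\
  forall u, 0 <= u < 1 ->
    (forall i, (i <= n)%N -> sample i (rho 0%N) u = rho i) <->
    a <= u < a + \prod_(i < n) trans (rho i) (rho i.+1).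
Proof.
elim: n rho => [|n IH] rho.
  exists 0 => //; rewrite big_ord0 add0r; split=> // u u01.
  by split=> // _ i; rewrite leqn0 => /eqP ->.
have [a a0 [al aP]] := IH (fun i => rho i.+1).
rewrite big_ord_recl /=; set l := \prod_(i < n) _ in al aP *.
set s := rho 0%N; set t := rho 1%N; set p := trans s t.
set c := cum s (pickle t).
have l0 : 0 <= l.
  by apply: prodr_ge0 => i _; case/andP: (trans01 (rho i.+1) (rho i.+2)).
have p0 : 0 <= p by case/andP: (trans01 s t).
have c0 : 0 <= c by exact: cum_ge0.
have cp1 : c + p <= 1 by rewrite /c /p -wt_pickle -cumS cum_le1.
have hb : c + p * a + p * l <= c + p.
  by rewrite -addrA lerD2l -mulrDr ler_piMr.
exists (c + p * a); first by rewrite addr_ge0 // mulr_ge0.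
split=> [|u u01]; first exact: le_trans hb cp1.
have step : (forall i, (i <= n.+1)%N -> sample i s u = rho i) <->
    next_spec s u t /\
    (forall i, (i <= n)%N -> sample i t (resid s u) = rho i.+1).
  split=> [h|[/(nextP _ _ u01) e h] [|i] //= hi]; last by rewrite e h.
  have e : next s u = t by have := h 1%N isT.
  split; first exact/nextP.
  by move=> i hi; have := h i.+1 hi; rewrite /= e.
rewrite step; split.
  move=> [ns h]; have /andP[h1 h2] := ns.
  have pgt0 : 0 < p by move: (le_lt_trans h1 h2); rewrite ltrDl.
  have er : resid s u = (u - c) / p by rewrite /resid ((nextP _ _ u01).2 ns).
  have r01 : 0 <= (u - c) / p < 1.
    rewrite divr_ge0 ?subr_ge0 //= ltr_pdivrMr // mul1r ltrBlDl.
    exact: h2.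
  move: h; rewrite er (aP _ r01) ler_pdivlMr // ltr_pdivrMr //.
  rewrite lerBrDl ltrBlDl mulrDl addrA.
  by rewrite [a * p]mulrC [l * p]mulrC.
move=> /andP[h1 h2].
have ns : next_spec s u t.
  apply/andP; split; last exact: lt_le_trans h2 hb.
  by apply: le_trans h1; rewrite lerDl mulr_ge0.
split=> //; have /andP[h1' h2'] := ns.
have pgt0 : 0 < p by move: (le_lt_trans h1' h2'); rewrite ltrDl.
have er : resid s u = (u - c) / p by rewrite /resid ((nextP _ _ u01).2 ns).
have r01 : 0 <= (u - c) / p < 1.
  rewrite divr_ge0 ?subr_ge0 //= ltr_pdivrMr // mul1r ltrBlDl.
  exact: h2'.
rewrite er (aP _ r01) ler_pdivlMr // ltr_pdivrMr //.
rewrite lerBrDl ltrBlDl mulrDl addrA.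
by rewrite [a * p]mulrC [l * p]mulrC h1.
Qed.

Definition sample_run (s : state M) (u : R) : run_space :=
  if 0 <= u < 1 then (fun i => sample i s u) : run else fun=> s.

Lemma sample_run_cylinder s n (rho : run) :
  exists2 a : R, 0 <= a &
    let l := if rho 0%N == s then \prod_(i < n) trans (rho i) (rho i.+1) else 0 in
    a + l <= 1 /\
    sample_run s @^-1` cylinder n rho `&` `[0, 1[%classic = `[a, a + l[%classic.
Proof.
case: (eqVneq (rho 0%N) s) => [<-|ne] /=.
  have [a a0 [al aP]] := sample_cylinder n rho; exists a => //; split=> //.
  apply/seteqP; split=> u /=; rewrite !in_itv /sample_run /=.
    by move=> [+ u01]; rewrite u01 => /(aP _ u01).
  move=> h; have u01 : 0 <= u < 1.
    case/andP: h => h1 h2.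
    by rewrite (le_trans a0 h1) (lt_le_trans h2 al).
  by rewrite u01; split=> //; apply/(aP _ u01).
exists 0 => //; rewrite addr0; split=> //.
apply/seteqP; split=> u /=; rewrite !in_itv /sample_run /=; last first.
  by case/andP=> h1 /(le_lt_trans h1); rewrite ltxx.
move=> [+ u01]; rewrite u01 => /(_ 0%N isT) /= e.
by rewrite e eqxx in ne.
Qed.

Lemma measurable_sample_run s : @measurable_fun _ _ (measurableTypeR R) run_space setT (sample_run s).
Proof.
apply: (@measurability _ _ (measurableTypeR R) _ setT (sample_run s) cylinders) => //.
move=> _ [C [n [rho ->]] <-].
rewrite setTI -(setIT (_ @^-1` _)) -(setUv `[0, 1[%classic) setIUr.
have [a _ /= [_ ->]] := sample_run_cylinder s n rho.
apply: measurableU; first exact: measurable_itv.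
have [cs|ncs] := pselect (cylinder n rho (fun=> s)).
  rewrite setIidr; first by apply: measurableC; exact: measurable_itv.
  move=> u /=; rewrite in_itv /= => /negP/negbTE u01.
  by rewrite /sample_run /= u01.
rewrite (_ : _ `&` _ = set0) //; apply/seteqP; split=> u //= -[+ /negP].
by rewrite in_itv /= /sample_run => + /negbTE u01; rewrite u01.
Qed.

Lemma uniform_prob_itvco (a l : R) : 0 <= a -> 0 <= l -> a + l <= 1 ->
  uniform_prob (@ltr01 R) `[a, a + l[%classic = l%:E.
Proof.
move=> a0 l0 al; rewrite /uniform_prob (eq_integral (fun=> 1%:E)); last first.
  move=> x; rewrite inE /= in_itv /= => /andP[h1 h2].
  by rewrite /uniform_pdf subr0 invr1 (le_trans a0 h1) (ltW (lt_le_trans h2 al)).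
rewrite integral_cst; last exact: measurable_itv.
rewrite mul1e /= lebesgue_measure_itv /= lte_fin ltrDl.
case: ltP => [_|l0']; first by rewrite -EFinD [a + l]addrC addrK.
by congr EFin; apply/eqP; rewrite eq_le l0 l0'.
Qed.

Lemma run_measure_exists s : exists mu, is_run_measure s mu.
Proof.
exists (distribution (uniform_prob (@ltr01 R))
  (@mfun_Sub _ _ (measurableTypeR R) run_space _
     (mem_set (measurable_sample_run s)))) => n rho.
have [a a0 /= [al e]] := sample_run_cylinder s n rho.
move: al e; set l := (if _ then _ else _) => al e.
have l0 : 0 <= l.
  rewrite /l; case: ifP => // _.
  by apply: prodr_ge0 => i _; case/andP: (trans01 (rho i) (rho i.+1)).
pose Q : probability (measurableTypeR R) R := uniform_prob (@ltr01 R).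
pose E : set (measurableTypeR R) := sample_run s @^-1` cylinder n rho.
change (Q E = l%:E).
have mE : measurable E.
  rewrite /E -[X in measurable X]setTI; apply: measurable_sample_run => //.
  by apply: sub_sigma_algebra; exists n, rho.
pose I : set (measurableTypeR R) := `[0, 1[%classic.
have mI : measurable I by exact: measurable_itv.
have Q1 : Q I = 1%E.
  by have := @uniform_prob_itvco 0 1; rewrite add0r; apply.
have QI : Q (E `&` I) = l%:E.
  by rewrite /E e; exact: uniform_prob_itvco.
have -> : Q E = (Q (E `&` I) + Q (E `&` ~` I))%E.
  rewrite -[in LHS](setIT E) -(setUv I) setIUr.
  apply: measureU.
  - exact: measurableI.
  - exact: measurableI mE (measurableC mI).
  - by rewrite setIACA setICr setI0.
rewrite QI (_ : Q (E `&` ~` _) = 0%E) ?adde0 //.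
apply/eqP; rewrite eq_le measure_ge0 andbT.
rewrite (_ : 0%E = Q (~` I)); last first.
  by rewrite probability_setC // Q1 subee.
apply: le_measure; rewrite ?inE //; first exact: measurableI mE (measurableC mI).
exact: measurableC.
Qed.

Lemma run_measure_unique s mu1 mu2 :
  is_run_measure s mu1 -> is_run_measure s mu2 ->
  forall E : set run_space, measurable E -> mu1 E = mu2 E.
Proof.
move=> h1 h2 E mE.
pose G : set (set run_space) := cylinders `|` [set set0].
have sG : @measurable _ run_space = <<s G >>.
  apply/seteqP; split; first by apply: sub_sigma_algebra2 => X; left.
  apply: smallest_sub; first exact: smallest_sigma_algebra.
  by move=> X [CX|->]; [exact: sub_sigma_algebra|exact: sigma_algebra0].
have agree X : G X -> mu1 X = mu2 X.
  by move=> [[n [rho ->]]|->]; rewrite ?measure0 // h1 h2.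
pose g k : set run_space :=
  if pickle_inv k is Some t then cylinder 0 (fun=> t) else set0.
apply: (measure_unique G g) => //.
- move=> X Y [[n [rho ->]]|->]; last by rewrite set0I; right.
  move=> [[m [sigma ->]]|->]; last by rewrite setI0; right.
  have [[pi [p1 p2]]|no] := pselect (cylinder n rho `&` cylinder m sigma !=set0).
    left; exists (maxn n m), pi; apply/seteqP; split=> x /=.
      move=> [x1 x2] i; rewrite leq_max => /orP[] hi.
        by rewrite x1 // p1.
      by rewrite x2 // p2.
    move=> hx; split=> i hi; rewrite hx ?leq_max ?hi ?orbT //.
      exact: p1.
    exact: p2.
  right; apply/seteqP; split=> // x hx; apply: no; by exists x.
- move=> k; rewrite /g; case: pickle_inv => [t|]; [left|by right].
  by exists 0%N, (fun=> t).
- apply/seteqP; split=> // x _; exists (pickle (x 0%N)) => //.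
  by rewrite /g pickleK_inv => i; rewrite leqn0 => /eqP ->.
- move=> k; apply: le_lt_trans (ltry 1).
  apply: probability_le1; rewrite /g; case: pickle_inv => [t|//].
  by apply: sub_sigma_algebra; exists 0%N, (fun=> t).
Qed.

Definition run_measure (s : state M) : probability run_space R :=
  sval (cid (run_measure_exists s)).

Lemma run_measureP s : is_run_measure s (run_measure s).
Proof. exact: svalP (cid (run_measure_exists s)). Qed.

Definition compares (op : comparison_op) (q : threshold) (x : \bar R) : Prop :=
  match op with
  | Geq => ((ratr (sval q))%:E <= x)%E
  | Gt => ((ratr (sval q))%:E < x)%E
  end.

Fixpoint sat (s : state M) (phi : pctl A) : Prop :=
  match phi with
  | Atom a => a \in label s
  | NegAtom a => a \notin label s
  | And phi1 phi2 => sat s phi1 /\ sat s phi2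
  | Or phi1 phi2 => sat s phi1 \/ sat s phi2
  | Fin op q phi1 =>
      compares op q (run_measure s [set pi | exists i, sat (pi i) phi1])
  | Glob op q phi1 =>
      compares op q (run_measure s [set pi | forall i, sat (pi i) phi1])
  end.

Definition is_model (phi : pctl A) : Prop := sat (init M) phi.

End Runs.

Definition satisfiable (R : realType) (A : finType) (phi : pctl A) : Prop :=
  exists M : markov_chain R A, is_model M phi.

(* Main.v *)
Require Import Defs.
From HB Require Import structures.
From mathcomp Require Import all_boot all_order all_algebra.
From mathcomp Require Import all_classical all_reals all_analysis.

(** Along a run the set of valid [G_{=1}]-subformulae can only grow, so some
    reachable state [t] has a set that never grows again: each
    [G_{=1}]-subformula then holds at every state reachable from [t] or at none.
    For every subformula [F psi] such that [psi] holds somewhere below [t], pick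
    one witness. Arranging [t] and the witnesses in a deterministic cycle, every
    state is visited almost surely from every other one, so the exact thresholds
    become irrelevant and each chosen state still satisfies all the subformulae
    it satisfied in the original chain. *)

Set Implicit Arguments.
Unset Strict Implicit.
Unset Printing Implicit Defensive.

Import Order.TTheory GRing.Theory Num.Theory.
Local Open Scope classical_set_scope.
Local Open Scope ring_scope.

(** * Hitting events and reachability in an arbitrary chain *)

Section Reachability.
Context (R : realType) (A : finType) (M : markov_chain R A).
Implicit Types (s t u : state M) (P : set (state M)) (psi : pctl A).

Local Notation run_space := (g_sigma_algebraType (@cylinders R A M)).

Definition hits P : set run_space := [set pi | exists i, P (pi i)].

Definition prefix_cylinder (w : seq (state M)) : set run_space :=
  cylinder (size w).-1 (nth (init M) w).

(** Indexing finite words by their codes displays a hitting event as a countable union of cylinders.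
    The junk code of the empty word is harmless: the test and the cylinder both read the default
    state. *)
Definition hitting_prefix P (k : nat) : set run_space :=
  if pickle_inv k is Some w then
    if `[< P (nth (init M) w (size w).-1) >] then prefix_cylinder w else set0
  else set0.

Lemma hitsE P : hits P = \bigcup_k hitting_prefix P k.
Proof.
apply/seteqP; split=> [pi [i Pi]|pi [k _]].
  exists (pickle (mkseq pi i.+1)) => //.
  rewrite /hitting_prefix pickleK_inv size_mkseq /= nth_mkseq // asboolT //.
  by move=> j; rewrite size_mkseq /= => ji; rewrite nth_mkseq.
rewrite /hitting_prefix; case: pickle_inv => // w.
by case: asboolP => // Pw /(_ _ (leqnn _)) e; exists (size w).-1; rewrite e.
Qed.

Lemma measurable_cylinder n rho : measurable (cylinder n rho : set run_space).
Proof. by apply: sub_sigma_algebra; exists n, rho. Qed.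

Lemma measurable_hitting_prefix P k : measurable (hitting_prefix P k).
Proof.
rewrite /hitting_prefix; case: pickle_inv => // w; case: asboolP => // _.
exact: measurable_cylinder.
Qed.

Lemma measurable_hits P : measurable (hits P).
Proof.
by rewrite hitsE; apply: bigcupT_measurable => k; exact: measurable_hitting_prefix.
Qed.

Inductive reach s : state M -> Prop :=
| reach_refl : reach s s
| reach_step t u : reach s t -> 0 < trans t u -> reach s u.

Lemma reach_trans s t u : reach s t -> reach t u -> reach s u.
Proof. by move=> st; elim=> // v w _ sv vw; exact: reach_step sv vw. Qed.

Lemma reach_path s t : reach s t -> exists n (rho : run M),
  [/\ rho 0%N = s, rho n = t & 0 < \prod_(i < n) trans (rho i) (rho i.+1)].
Proof.
elim=> [|{}t u _ [n [rho [r0 rn pr]]] tu].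
  by exists 0%N, (fun=> s); rewrite big_ord0.
exists n.+1, (fun i => if (i <= n)%N then rho i else u).
split; rewrite ?leq0n ?ltnn // big_ord_recr /= leqnn ltnn rn mulr_gt0 //.
rewrite (eq_bigr (fun i : 'I_n => trans (rho i) (rho i.+1))) // => i _.
by rewrite ltn_ord ltnW.
Qed.

Lemma path_reach n (rho : run M) :
  \prod_(i < n) trans (rho i) (rho i.+1) != 0 -> reach (rho 0%N) (rho n).
Proof.
elim: n => [|n IH]; first by move=> _; exact: reach_refl.
rewrite big_ord_recr /= mulf_eq0 negb_or => /andP[/IH r t0].
apply: reach_step r _; rewrite lt_def t0.
by case/andP: (trans01 (rho n) (rho n.+1)).
Qed.

(** Each cylinder ending in [P] is null, since a nonzero product would make its last state
    reachable; countably many null sets remain null. *)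
Lemma hits_unreachable s P :
  (forall t, reach s t -> ~ P t) -> run_measure s (hits P) = 0%E.
Proof.
move=> nP; apply/measure_negligible; first exact: measurable_hits.
rewrite hitsE; apply: negligible_bigcup => k.
apply/negligibleP; first exact: measurable_hitting_prefix.
rewrite /hitting_prefix; case: pickle_inv => [w|]; last exact: measure0.
case: asboolP => [Pw|_]; last exact: measure0.
apply: etrans (run_measureP s _ _) _; case: eqP => // e; congr EFin.
by apply/eqP; apply/negPn/negP => /path_reach; rewrite e => /nP.
Qed.

Lemma hits_reachable s t P :
  reach s t -> P t -> (0 < run_measure s (hits P))%E.
Proof.
move=> /reach_path[n [rho [r0 rn pr]]] Pt.
apply: (@lt_le_trans _ _ (run_measure s (cylinder n rho))).
  by rewrite run_measureP r0 eqxx lte_fin.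
apply: le_measure; rewrite ?inE //; first exact: measurable_cylinder.
  exact: measurable_hits.
by move=> pi h; exists n; rewrite h // rn.
Qed.

(** A reachable state violating [psi] would be hit with positive probability, leaving less than 1
    for the complement. *)
Lemma sat_Glob1_reach s t psi : sat s (Glob1 psi) -> reach s t -> sat t psi.
Proof.
move=> /= + st; rewrite rmorph1 => h; apply: contrapT => nt.
move: h; rewrite (_ : [set _ | _] = ~` hits [set u | ~ sat u psi]); last first.
  apply/seteqP; split=> pi /=; first by move=> h [i]; apply; exact: h.
  by move=> h i; apply: contrapT => ni; apply: h; exists i.
rewrite probability_setC; last exact: measurable_hits.
have := hits_reachable (P := [set u | ~ sat u psi]) st nt.
have := fin_num_measure (run_measure s) _ (measurable_hits [set u | ~ sat u psi]).
by case: (run_measure s _) => // r _; rewrite lte_fin lee_fin lerBrDr gerDl => /lt_geF ->.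
Qed.

Lemma compares_le op q (x y : \bar R) : (x <= y)%E ->
  compares op q x -> compares op q y.
Proof.
by case: op => /= xy h; [exact: le_trans h xy|exact: lt_le_trans h xy].
Qed.

(** Excludes [> 1], the only bound that almost sure reachability does not meet. *)
Lemma sat_Fin_compares1 s op q psi : sat s (Fin op q psi) ->
  compares op q (1%E : \bar R).
Proof.
apply: compares_le; apply: probability_le1.
exact: (measurable_hits (fun u => sat u psi)).
Qed.

(** The left alternative is the bound [>= 0], the only one satisfied without any witness. *)
Lemma sat_Fin_reach s op q psi : sat s (Fin op q psi) ->
  compares op q (0%E : \bar R) \/ exists2 t, reach s t & sat t psi.
Proof.
move=> h; have [ex|nex] := pselect (exists2 t, reach s t & sat t psi).
  by right.
left; move: h => /=; rewrite -(@hits_unreachable s (fun u => sat u psi)) //.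
by move=> t st tpsi; apply: nex; exists t.
Qed.

(** Satisfaction of [G_{=1}] is expressed through reachability, so each [Glob] is read with bound 1,
    as in the fragment. *)
Fixpoint glob_stable t psi : Prop :=
  match psi with
  | And psi1 psi2 => glob_stable t psi1 /\ glob_stable t psi2
  | Fin _ _ psi1 => glob_stable t psi1
  | Glob _ _ psi1 => glob_stable t psi1 /\
      ((forall u, reach t u -> sat u psi1) \/
       (forall u, reach t u -> ~ forall v, reach u v -> sat v psi1))
  | _ => True
  end.

Lemma glob_stable_reach s t psi :
  reach s t -> glob_stable s psi -> glob_stable t psi.
Proof.
move=> st; elim: psi => //= [p1 IH1 p2 IH2 [/IH1 ? /IH2 ?]//|_ _ p IH [/IH ? h]].
split=> //; case: h => h; [left|right] => u tu; apply: h; exact: reach_trans tu.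
Qed.

(** Subformulae are settled one after another by moving further down; stability already gained
    persists by [glob_stable_reach]. *)
Lemma glob_stable_ex s psi : exists2 t, reach s t & glob_stable t psi.
Proof.
elim: psi s => [a|a|p1 IH1 p2 IH2|p1 _ p2 _|op q p IH|op q p IH] s /=;
  try by exists s => //; exact: reach_refl.
- have [t st t1] := IH1 s; have [u tu u2] := IH2 t.
  by exists u; [exact: reach_trans tu|split=> //; exact: glob_stable_reach t1].
- exact: IH.
- have [t st tp] := IH s.
  have [[u tu hu]|h] :=
    pselect (exists2 u, reach t u & forall v, reach u v -> sat v p).
    by exists u; [exact: reach_trans tu|split; [exact: glob_stable_reach tp|left]].
  exists t => //; split=> //; right=> u tu hu; apply: h; by exists u.
Qed.

End Reachability.

(** * Deterministic cycles *)

Section Cycle.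
Context (R : realType) (A : finType) (n : nat) (lab : 'I_n.+1 -> {set A}).

Definition cycle_trans (i j : 'I_n.+1) : R := (j == ordS i)%:R.

Lemma cycle_trans01 i j : 0 <= cycle_trans i j <= 1.
Proof. by rewrite ler0n lern1 leq_b1. Qed.

Lemma cycle_trans_sum1 i : (\esum_(j in [set: 'I_n.+1]) (cycle_trans i j)%:E = 1)%E.
Proof.
transitivity (\esum_(j in [set ordS i]) (1%E : \bar R))%E; last exact: esum_set1.
rewrite [RHS]esum_mkcond; apply: eq_esum => j _.
by rewrite /cycle_trans; case: eqP => [->|ji]; [rewrite mem_set|rewrite memNset].
Qed.

Definition cycle_chain : markov_chain R A :=
  @MarkovChain R A 'I_n.+1 cycle_trans ord0 lab cycle_trans01 cycle_trans_sum1.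

Lemma val_iter_ordS k (i : 'I_n.+1) : iter k (@ordS _) i = ((i + k) %% n.+1)%N :> nat.
Proof.
elim: k => [|k IH]; first by rewrite addn0 modn_small.
by rewrite iterS /= IH -addn1 modnDml addn1 addnS.
Qed.

Lemma iter_ordS_ex (i j : 'I_n.+1) : exists k, iter k (@ordS _) i = j.
Proof.
(* From [i], [n.+1 - i] steps lead to 0, and [j] more lead to [j]. *)
exists (n.+1 - i + j)%N; apply: val_inj; rewrite /= val_iter_ordS addnA subnKC 1?ltnW //.
by rewrite modnDl modn_small.
Qed.

(** The cylinder of the deterministic run from [i] up to its arrival at [j] already has probability
    1. *)
Lemma cycle_hits (i j : state cycle_chain) (P : set (state cycle_chain)) : P j ->
  run_measure i (hits P) = 1%E.
Proof.
move=> Pj; have [k ij] := iter_ordS_ex i j.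
pose rho : run cycle_chain := fun m => iter m (@ordS _) i.
apply/eqP; rewrite eq_le; apply/andP; split.
  by apply: probability_le1; exact: measurable_hits.
apply: (@le_trans _ _ (run_measure i (cylinder k rho))).
  rewrite run_measureP eqxx big1 // => m _.
  by rewrite /= /cycle_trans eqxx.
apply: le_measure; rewrite ?inE //; first exact: measurable_cylinder.
  exact: measurable_hits.
by move=> pi h; exists k; rewrite h // /rho ij.
Qed.

Lemma cycle_sat_Fin (i : state cycle_chain) op q psi :
  compares op q (1%E : \bar R) ->
  compares op q (0%E : \bar R) \/ (exists j : state cycle_chain, sat j psi) ->
  sat i (Fin op q psi).
Proof.
move=> h1 [|[j hj]] /=; first by apply: compares_le; exact: measure_ge0.
by rewrite (cycle_hits i (P := fun j => sat j psi) hj).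
Qed.

Lemma cycle_sat_Glob1 (i : state cycle_chain) psi :
  (forall j : state cycle_chain, sat j psi) -> sat i (Glob1 psi).
Proof.
move=> h /=; rewrite (_ : [set _ | _] = setT) ?probability_setT ?rmorph1 //.
by apply/seteqP; split=> // pi _ k.
Qed.

End Cycle.

(** * The cycle through [t] and a list of witnesses *)

Section ListCycle.
Context (R : realType) (A : finType) (M : markov_chain R A) (t : state M).

(** States are positions, so [T] may contain repetitions; position 0 carries [t]. *)
Definition list_cycle (T : seq (state M)) : markov_chain R A :=
  cycle_chain R (fun i : 'I_(size T).+1 => label (nth t (t :: T) i)).

Lemma nth_list_cycle_reach (T : seq (state M)) (i : state (list_cycle T)) :
  {in T, forall u, reach t u} -> reach t (nth t (t :: T) i).
Proof.
move=> hT; have : nth t (t :: T) i \in t :: T by apply: mem_nth; exact: ltn_ord.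
by rewrite inE => /orP[/eqP ->|/hT//]; exact: reach_refl.
Qed.

(** Quantifying over all lists [T] that extend [T0] lets the witnesses of different subformulae
    share one cycle. *)
Lemma list_cycle_sat psi : FqG1_formula psi -> glob_stable t psi ->
  exists T0 : seq (state M), [/\ (size T0 < flength psi)%N,
    {in T0, forall u, reach t u} &
    forall T, {subset T0 <= T} -> {in T, forall u, reach t u} ->
      forall i : state (list_cycle T), sat (nth t (t :: T) i) psi -> sat i psi].
Proof.
elim=> {psi}[a|a|p1 p2 _ IH1 _ IH2|op q p _ IH|p _ IH] /= st.
- by exists [::].
- by exists [::].
- have [T1 [s1 r1 h1]] := IH1 st.1; have [T2 [s2 r2 h2]] := IH2 st.2.
  exists (T1 ++ T2); split.
  + by rewrite size_cat ltnS leq_add // ltnW.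
  + by move=> u; rewrite mem_cat => /orP[/r1|/r2].
  + move=> T sT rT i [/h1 k1 /h2 k2].
    by split; [apply: k1|apply: k2] => // u hu; apply: sT; rewrite mem_cat hu ?orbT.
- have [T0 [s0 r0 h0]] := IH st.
  have [[v tv vp]|nex] := pselect (exists2 v, reach t v & sat v p).
    exists (v :: T0); split=> //.
      by move=> u; rewrite inE => /orP[/eqP ->|/r0].
    move=> T sT rT i ip; apply: cycle_sat_Fin (sat_Fin_compares1 ip) _; right.
    have vT : v \in T by apply: sT; rewrite mem_head.
    (* The shift by one accounts for [t] at the head of the cycle. *)
    have lt : ((index v T).+1 < (size T).+1)%N by rewrite ltnS index_mem.
    exists (Ordinal lt); apply: h0 => //; last by rewrite /= nth_index.
    by move=> u uT0; apply: sT; rewrite inE uT0 orbT.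
  exists T0; split=> [|//|T sT rT i ip]; first exact: ltnW.
  apply: cycle_sat_Fin (sat_Fin_compares1 ip) _.
  (* A witness below position [i] would also lie below [t], so only the bound [>= 0] is possible
     here. *)
  case: (sat_Fin_reach ip) => [|[v iv vp]]; first by left.
  by case: nex; exists v => //; exact: reach_trans (nth_list_cycle_reach i rT) iv.
- have [T0 [s0 r0 h0]] := IH st.1; exists T0; split=> [|//|T sT rT i ip].
    exact: ltnW.
  apply: cycle_sat_Glob1 => j; apply: h0 => //.
  (* [G_{=1} p] holds at a state below [t], which rules out the second alternative of stability;
     hence [p] holds at every state on the cycle. *)
  case: st.2 => h; first exact/h/nth_list_cycle_reach.
  by case: (h _ (nth_list_cycle_reach i rT)) => v; exact: sat_Glob1_reach ip.
Qed.

End ListCycle.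

Theorem theorem2 (R : realType) (A : finType) (phi : pctl A)
    (hphi : G1FqG1_formula phi) (hsat : satisfiable R phi) :
  exists M : markov_chain R A,
    is_model M phi /\ ([set: state M] #<= `I_(flength phi))%card.
Proof.
case: hphi hsat => psi fpsi -> [M Mphi].
have [t st stable] := glob_stable_ex (init M) psi.
have [T [sT rT hT]] := list_cycle_sat fpsi stable.
exists (list_cycle t T); split; last first.
  (* The cycle has [(size T).+1] states, at most the length of [psi]. *)
  rewrite -(card_le_eql card_II) card_le_II /=.
  exact: ltnW.
apply: cycle_sat_Glob1 => i; apply: hT => //.
exact: sat_Glob1_reach Mphi (reach_trans st (nth_list_cycle_reach i rT)).
Qed.
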